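(* Let $m,n$ be positive integers, $c\in\mathbb{R}^n$, $d\in\mathbb{R}$, $A\in\mathbb{R}^{m\times n}$, $b\in\mathbb{R}^m$, and let $f:\mathbb{R}^n\to\mathbb{R}$ be defined by $f(x)=c^Tx+d-\|Ax+b\|$. Put $M=A^TA$, $x_*=-A^+b$, and $\delta=\|Ax_*+b\|$. Then $M$ is positive semidefinite and, for all $x\in\mathbb{R}^n$, $$f(x)=c^Tx+d-\sqrt{\delta^2+(x-x_* )^TM(x-x_* )}.$$
   Context: $\|\cdot\|$ is the Euclidean norm and $A^+\in\mathbb{R}^{n\times m}$ is the Moore–Penrose pseudoinverse of $A$. A positive semidefinite matrix is a real symmetric matrix with non-negative eigenvalues. *)

(* Defs.v *)
From HB Require Import structures.
From mathcomp Require Import all_boot all_order all_algebra.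

Set Implicit Arguments.
Unset Strict Implicit.
Unset Printing Implicit Defensive.

Import Order.TTheory GRing.Theory Num.Theory.
Local Open Scope ring_scope.

(* Vectors are columns 'cV[R]_n, so the scalar u^T v is the only entry of the
   1 x 1 matrix u^T *m v, written (u^T *m v) 0 0. *)

Definition enorm (R : rcfType) (n : nat) (v : 'cV[R]_n) : R :=
  Num.sqrt (\sum_(i < n) v i 0 ^+ 2).

(* [eigenvalue] uses row eigenvectors; a square matrix and its transpose have
   the same eigenvalues.  Quantifying over a : R loses none of them, since a real
   symmetric matrix has only real eigenvalues. *)
Definition psdmx (R : rcfType) (n : nat) (M : 'M[R]_n) : Prop :=
  M^T = M /\ forall a : R, eigenvalue M a -> 0 <= a.

Definition penrose (R : realFieldType) (m n : nat)
    (A : 'M[R]_(m, n)) (X : 'M[R]_(n, m)) : bool :=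
  [&& A *m X *m A == A, X *m A *m X == X,
      (A *m X)^T == A *m X & (X *m A)^T == X *m A].

Lemma gram_unitmx (R : realFieldType) (m n : nat) (B : 'M[R]_(m, n)) :
  row_free B -> B *m B^T \in unitmx.
Proof.
move=> fB; rewrite -row_free_unit -kermx_eq0; apply/eqP/row_matrixP => k.
rewrite row0; set v := row k _.
have vBB : v *m (B *m B^T) = 0 by rewrite -row_mul mulmx_ker row0.
suff vB : v *m B = 0 by apply: (row_free_inj fB); rewrite vB mul0mx.
have /(congr1 (fun N : 'M_1 => N 0 0)) : (v *m B) *m (v *m B)^T = 0.
  by rewrite trmx_mul mulmxA -(mulmxA v) vBB mul0mx.
rewrite !mxE => /psumr_eq0P vB0; apply/rowP => j; rewrite [RHS]mxE.
have /vB0/(_ j isT)/eqP : forall i, true ->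
    0 <= (v *m B) 0 i * (v *m B)^T i 0.
  by move=> i _; rewrite [_^T _ _]mxE -expr2 sqr_ge0.
by rewrite [_^T _ _]mxE mulf_eq0 orbb => /eqP.
Qed.

Lemma penrose_exists (R : realFieldType) (m n : nat) (A : 'M[R]_(m, n)) :
  exists X, penrose A X.
Proof.
have [r [C [B [fC fB ->]]]] : exists r (C : 'M[R]_(m, r)) (B : 'M[R]_(r, n)),
    [/\ row_free C^T, row_free B & A = C *m B].
  exists (\rank A), (col_base A), (row_base A); split; last 1 first.
  - by rewrite mulmx_base.
  - by rewrite /row_free mxrank_tr; exact: col_base_full.
  - exact: row_base_free.
have uB : B *m B^T \in unitmx by exact: gram_unitmx.
have uC : C^T *m C \in unitmx by rewrite -{2}[C]trmxK gram_unitmx.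
pose P := invmx (B *m B^T); pose Q := invmx (C^T *m C).
have PT : P^T = P by rewrite /P trmx_inv trmx_mul trmxK.
have QT : Q^T = Q by rewrite /Q trmx_inv trmx_mul trmxK.
pose X := B^T *m P *m Q *m C^T; exists X.
have AX : C *m B *m X = C *m Q *m C^T.
  rewrite /X !mulmxA -(mulmxA C B).
  by rewrite -(mulmxA C (B *m B^T)) mulmxV // mulmx1.
have XA : X *m (C *m B) = B^T *m P *m B.
  rewrite /X !mulmxA -(mulmxA _ C^T C).
  by rewrite -(mulmxA _ Q) mulVmx // mulmx1.
apply/and4P; split; apply/eqP.
- rewrite AX !mulmxA -(mulmxA _ C^T C).
  by rewrite -(mulmxA C Q) mulVmx // mulmx1.
- rewrite XA /X !mulmxA -(mulmxA _ B B^T).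
  by rewrite -(mulmxA B^T P (B *m B^T)) mulVmx // mulmx1.
- by rewrite AX !trmx_mul trmxK QT mulmxA.
- by rewrite XA !trmx_mul trmxK PT mulmxA.
Qed.

Lemma penrose_unique (R : realFieldType) (m n : nat) (A : 'M[R]_(m, n))
    (X Y : 'M[R]_(n, m)) : penrose A X -> penrose A Y -> X = Y.
Proof.
case/and4P=> /eqP AXA /eqP XAX /eqP AXs /eqP XAs.
case/and4P=> /eqP AYA /eqP YAY /eqP AYs /eqP YAs.
have eAX : A *m X = A *m Y.
  by rewrite -AXs -{1}AYA -mulmxA trmx_mul AXs AYs mulmxA AXA.
have eXA : X *m A = Y *m A.
  rewrite -XAs -{1}AYA -(mulmxA A) mulmxA trmx_mul XAs YAs.
  by rewrite -mulmxA (mulmxA A) AXA.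
by rewrite -XAX eXA -mulmxA eAX mulmxA YAY.
Qed.

Definition mppinv (R : realFieldType) (m n : nat)
    (A : 'M[R]_(m, n)) : 'M[R]_(n, m) :=
  xchoose (penrose_exists A).

Lemma mppinvP (R : realFieldType) (m n : nat) (A : 'M[R]_(m, n)) :
  penrose A (mppinv A).
Proof. exact: xchooseP. Qed.

(* Main.v *)
Require Import Defs.
From mathcomp Require Import all_boot all_order all_algebra reals.

(** With r = A x_* + b the residual at x_*, and y = x - x_*, one has
    A x + b = r + A y.  The point x_* is a least-squares solution, i.e. it
    satisfies the normal equations A^T r = 0: this is where the choice
    x_* = - A^+ b enters, since A A^+ is symmetric and A A^+ A = A, whence
    A^T A A^+ = A^T ([penrose_tr_mul]).  Hence r is orthogonal to the image
    of A, and by Pythagoras ([sqnorm_addmx])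
      ||A x + b||^2 = ||r||^2 + ||A y||^2 = delta^2 + y^T A^T A y;
    taking square roots gives the formula.  Positive semidefiniteness of A^T A
    comes from the Rayleigh quotient: if v is an eigenvector for a, then
    a ||v||^2 = ||A v||^2 ([psdmx_gram]). *)

Set Implicit Arguments.
Unset Strict Implicit.
Unset Printing Implicit Defensive.

Import Order.TTheory GRing.Theory Num.Theory.
Local Open Scope ring_scope.

Lemma sqnormE (R : realFieldType) (n : nat) (v : 'cV[R]_n) :
  (v^T *m v) 0 0 = \sum_(i < n) v i 0 ^+ 2.
Proof. by rewrite mxE; apply: eq_bigr => i _; rewrite mxE expr2. Qed.

Lemma sqnorm_ge0 (R : realFieldType) (n : nat) (v : 'cV[R]_n) :
  0 <= (v^T *m v) 0 0.
Proof. by rewrite sqnormE sumr_ge0 // => i _; exact: sqr_ge0. Qed.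

Lemma sqnorm_eq0 (R : realFieldType) (n : nat) (v : 'cV[R]_n) :
  ((v^T *m v) 0 0 == 0) = (v == 0).
Proof.
apply/eqP/eqP => [|->]; last by rewrite mulmx0 mxE.
rewrite sqnormE => /psumr_eq0P v0; apply/colP => i; rewrite [RHS]mxE.
by apply/eqP; rewrite -sqrf_eq0; apply/eqP/v0 => // j _; exact: sqr_ge0.
Qed.

Lemma enormE (R : rcfType) (n : nat) (v : 'cV[R]_n) :
  enorm v = Num.sqrt ((v^T *m v) 0 0).
Proof. by rewrite /enorm -sqnormE. Qed.

Lemma sqr_enorm (R : rcfType) (n : nat) (v : 'cV[R]_n) :
  enorm v ^+ 2 = (v^T *m v) 0 0.
Proof. by rewrite enormE sqr_sqrtr // sqnorm_ge0. Qed.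

(** The Rayleigh quotient of an eigenvector is its eigenvalue, and that of
    [A^T *m A] is a quotient of squared norms.  Since [eigenvalue] provides a row
    eigenvector [v], the column to which [A] is applied is [v^T]. *)
Lemma psdmx_gram (R : rcfType) (m n : nat) (A : 'M[R]_(m, n)) :
  psdmx (A^T *m A).
Proof.
split=> [|a /eigenvalueP[v vM v_neq0]]; first by rewrite trmx_mul trmxK.
have v_gt0 : 0 < (v^T^T *m v^T) 0 0.
  by rewrite lt0r sqnorm_eq0 trmx_eq0 v_neq0 sqnorm_ge0.
have rayleigh : ((A *m v^T)^T *m (A *m v^T)) 0 0 = a * (v^T^T *m v^T) 0 0.
  by rewrite trmx_mul trmxK mulmxA -(mulmxA v) vM -scalemxAl mxE.
by rewrite -(pmulr_lge0 _ v_gt0) -rayleigh sqnorm_ge0.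
Qed.

(** Transposing [A *m X *m A = A] and using the symmetry of [A *m X].  It says
    that [A *m X] projects orthogonally onto the image of [A], so that
    [X *m b] solves the normal equations for every [b]. *)
Lemma penrose_tr_mul (R : realFieldType) (m n : nat) (A : 'M[R]_(m, n))
    (X : 'M[R]_(n, m)) : penrose A X -> A^T *m (A *m X) = A^T.
Proof.
by case/and4P=> /eqP AXA _ /eqP AXs _; rewrite -{1}AXs -trmx_mul AXA.
Qed.

(** Pythagoras: the cross terms vanish because [r] is orthogonal to the image
    of [A]. *)
Lemma sqnorm_addmx (R : realFieldType) (m n : nat) (A : 'M[R]_(m, n))
    (r : 'cV[R]_m) (y : 'cV[R]_n) : A^T *m r = 0 ->
  (r + A *m y)^T *m (r + A *m y) = r^T *m r + y^T *m (A^T *m A) *m y.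
Proof.
move=> Ar0; have rA0 : r^T *m A = 0 by rewrite -[A]trmxK -trmx_mul Ar0 trmx0.
rewrite [(r + _)^T]linearD /= [(A *m y)^T]trmx_mul mulmxDl !mulmxDr.
rewrite mulmxA rA0 mul0mx addr0.
by rewrite -(mulmxA _ _ r) Ar0 mulmx0 add0r !mulmxA.
Qed.

Theorem theorem7 (R : realType) (m n : nat) (hm : (0 < m)%N) (hn : (0 < n)%N)
    (c : 'cV[R]_n) (d : R) (A : 'M[R]_(m, n)) (b : 'cV[R]_m) :
  let f := fun x : 'cV[R]_n => (c^T *m x) 0 0 + d - enorm (A *m x + b) in
  let M := A^T *m A in
  let xstar := - (mppinv A *m b) in
  let delta := enorm (A *m xstar + b) in
  psdmx M /\
  forall x : 'cV[R]_n,
    f x = (c^T *m x) 0 0 + d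
          - Num.sqrt (delta ^+ 2 + ((x - xstar)^T *m M *m (x - xstar)) 0 0).
Proof.
move=> f M xstar delta; split=> [|x]; first exact: psdmx_gram.
have normal_eq : A^T *m (A *m xstar + b) = 0.
  rewrite /xstar mulmxN mulmxDr mulmxN !mulmxA -(mulmxA A^T).
  by rewrite (penrose_tr_mul (mppinvP A)) addNr.
have split_residual : A *m x + b = (A *m xstar + b) + A *m (x - xstar).
  by rewrite mulmxBr addrAC [A *m xstar + _]addrC subrK.
rewrite /f /delta sqr_enorm split_residual enormE.
by rewrite (sqnorm_addmx _ normal_eq) [X in Num.sqrt X]mxE.
Qed.
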